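(* Every $\sigma(\varphi)$-measurable solution $X^*$ of the Neyman–Pearson problem for $\rho$ with capital constraint $v\in[0,K]$ can be written ($P$-a.s.) as $X^*=f^*(\varphi)$ for some deterministic increasing function $f^*$.
   Context: $(\Omega,\mathcal F,P)$ is an atomless probability space, $L^\infty=L^\infty(\Omega,\mathcal F,P)$, $K>0$ is a constant, and the price density $\varphi$ is a random variable with $\varphi>0$ $P$-a.s. and $E[\varphi]=1$ (expectations are under $P$). ''Increasing'' means nondecreasing. $\rho:L^\infty\to\mathbb R$ is a functional satisfying, for all $X,Y\in L^\infty$: - monotonicity: $X\le Y$ implies $\rho(-X)\le\rho(-Y)$; - convexity: $\rho(\lambda X+(1-\lambda)Y)\le\lambda\rho(X)+(1-\lambda)\rho(Y)$ for $0\le\lambda\le1$; - law invariance: if $X$ and $Y$ have the same law under $P$, then $\rho(X)=\rho(Y)$; - $m\mapsto\rho(-m)$ ($m$ a real constant) is continuous and strictly increasing on $[0,K]$; - continuity from above: if $X_n\searrow X$ $P$-a.s., then $\rho(X_n)\nearrow\rho(X)$. The Neyman–Pearson problem for $\rho$ with capital constraint $v\in[0,K]$ is: minimize $\rho(-X)$ over all ($\mathcal F$-measurable) random variables $X$ with $0\le X\le K$ and $E[\varphi X]\ge v$. A solution is a minimizer. *)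

(* Defs.v *)
From HB Require Import structures.
From mathcomp Require Import all_boot all_order all_algebra.
From mathcomp Require Import all_classical all_reals all_analysis ess_sup_inf.

Set Implicit Arguments.
Unset Strict Implicit.
Unset Printing Implicit Defensive.

Import Order.TTheory GRing.Theory Num.Theory.
Import numFieldNormedType.Exports.

Local Open Scope classical_set_scope.
Local Open Scope ring_scope.

Definition atomless d (T : measurableType d) (R : realType)
    (P : probability T R) : Prop :=
  ~ exists A : set T, [/\ measurable A, (0 < P A)%E &
      forall B : set T, measurable B -> B `<=` A -> P B = 0%E \/ P B = P A].

(* The elements are functions, not classes modulo a.s. equality. A law-invariant
   functional takes the same value on a.s. equal functions, so it amounts to a
   functional on the quotient space. *)
Definition Linfty d (T : measurableType d) (R : realType)
    (P : probability T R) := LfunType P (leey (1 : \bar R)%E).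

Lemma Linfty_cst_subproof d (T : measurableType d) (R : realType)
    (P : probability T R) (c : R) : cst c \in Lfun P +oo%E.
Proof.
rewrite inE/=; apply/andP; split; rewrite inE//=.
rewrite /finite_norm unlock /Lnorm; case: ifPn => // P0.
rewrite (_ : abse \o _ = cst `|c|%:E)//.
by rewrite (@ess_sup_ae_cst _ _ _ P _ `|c|%:E) ?ltry//; exact: aeW.
Qed.

Definition Linfty_cst d (T : measurableType d) (R : realType)
    (P : probability T R) (c : R) : Linfty P :=
  Lfun_Sub (leey (1 : \bar R)%E) (Linfty_cst_subproof P c).

Section functionals.
Context d (T : measurableType d) (R : realType) (P : probability T R).
Variable rho : Linfty P -> R.

Definition monotone_functional : Prop := forall X Y : Linfty P,
  (\forall w \ae P, X w <= Y w) -> rho (- X) <= rho (- Y).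

Definition convex_functional : Prop :=
  forall (X Y : Linfty P) (lambda : R), 0 <= lambda <= 1 ->
    rho (lambda *: X + (1 - lambda) *: Y)
      <= lambda * rho X + (1 - lambda) * rho Y.

(* [distribution P X] is a function on all sets, whose values on non-measurable
   sets are irrelevant: laws are compared on Borel sets only. *)
Definition law_invariant : Prop := forall X Y : Linfty P,
  (forall B : set R, measurable B -> distribution P X B = distribution P Y B) ->
  rho X = rho Y.

Definition continuous_from_above : Prop :=
  forall (X_ : nat -> Linfty P) (X : Linfty P),
    (\forall w \ae P, nonincreasing_seq (fun n => X_ n w) /\
                      X_ n w @[n --> \oo] --> X w) ->
    nondecreasing_seq (fun n => rho (X_ n)) /\
    rho (X_ n) @[n --> \oo] --> rho X.

End functionals.

(* A random variable X with 0 <= X <= K a.s. is bounded, so nothing is lost by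
   letting X range over [Linfty P]. *)
Definition NP_feasible d (T : measurableType d) (R : realType)
    (P : probability T R) (phi : {RV P >-> R}) (K v : R) (X : Linfty P) : Prop :=
  (\forall w \ae P, 0 <= X w <= K) /\ (v%:E <= 'E_P[fun w => (phi w * X w)%R])%E.

Definition NP_solution d (T : measurableType d) (R : realType)
    (P : probability T R) (rho : Linfty P -> R) (phi : {RV P >-> R}) (K v : R)
    (X : Linfty P) : Prop :=
  NP_feasible phi K v X /\
  forall Y : Linfty P, NP_feasible phi K v Y -> rho (- X) <= rho (- Y).

(* Main.v *)
Require Import Defs.
From HB Require Import structures.
From mathcomp Require Import all_boot all_order all_algebra.
From mathcomp Require Import all_classical all_reals all_analysis.
From mathcomp Require Import ess_sup_inf measurable_realfun.
From mathcomp Require Import ring lra.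

Set Implicit Arguments.
Unset Strict Implicit.
Unset Printing Implicit Defensive.

Import Order.TTheory GRing.Theory Num.Theory.
Import numFieldNormedType.Exports.

Local Open Scope classical_set_scope.
Local Open Scope ring_scope.

(** Suppose that a solution X and phi are not increasing together. Then for some
s < t and c < c' the events {phi <= s, X >= c'} and {phi >= t, X <= c} both have
positive probability. Moving the large values of X from the first event to the
second raises E[phi X] because phi is larger there, while the law of X, and so
its risk, need not change.

A transfer of the exact conditional laws is not required. Cut both events into
slices on which X varies by less than eta, take one slice of positive
probability in each, with lower values a > b, and shrink the two slices to sets
A and B of the same probability, which an atomless space allows
([atomless_subset]). Lower X to a on A and to b on B: by monotonicity the risk
does not go up. Then exchange a and b: the law is the same
([rho_overwrite_sym]). When eta is small against (c' - c) (t - s) / t, the gain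
on B exceeds the loss on A together with the rounding
([expectation_overwrite_swap]), so the result Y has risk at most that of X and
E[phi Y] > v.

The slack in the constraint can be spent by scaling Y with a factor
lambda = v / E[phi Y] < 1. By convexity the risk of lambda Y is at most
lambda rho(-Y) + (1 - lambda) rho(0), which is strictly below rho(-X) as soon as
rho(0) < rho(-X) ([slack_suboptimal]). This strict inequality holds for every
X >= 0 that is not a.s. zero ([rho0_lt_opp]): averaging two equally likely
disjoint copies of an indicator spreads it over twice the probability at half
the height without raising the risk, and after finitely many doublings only a
positive constant remains, whose risk is above rho(0) by assumption.

Hence, outside a null set, phi w < phi w' implies X w <= X w'
([no_inversion_comonotone]). Since X is sigma(phi)-measurable, it is constant on
the fibres of phi ([preimage_measurable_factor]), and the running supremum of X
over {phi <= x} is the required increasing function ([increasing_factor]). *)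

(** * Subsets of prescribed probability in an atomless space *)

Section atomless.
Context d (T : measurableType d) (R : realType) (P : probability T R).
Context (P_atomless : atomless P).

Let m (A : set T) : R := fine (P A).

Let mE A : measurable A -> P A = (m A)%:E.
Proof. by move=> mA; rewrite fineK// fin_num_measure. Qed.

Let m_ge0 A : 0 <= m A. Proof. exact: fine_ge0. Qed.

Let mU A B : measurable A -> measurable B -> A `&` B = set0 ->
  m (A `|` B) = m A + m B.
Proof.
move=> mA mB AB; apply: EFin_inj.
by rewrite EFinD -!mE// ?measureU//; exact: measurableU.
Qed.

Let mDK A B : measurable A -> measurable B -> B `<=` A -> m A = m B + m (A `\` B).
Proof.
move=> mA mB BA; rewrite -mU//; last by rewrite setDIK.
  by rewrite setDUK.
exact: measurableD.
Qed.

Let le_m A B : measurable A -> measurable B -> A `<=` B -> m A <= m B.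
Proof. by move=> mA mB AB; rewrite (mDK mB mA AB) lerDl. Qed.

Let half_subset A : measurable A -> 0 < m A ->
  exists B, [/\ measurable B, B `<=` A, 0 < m B & 2 * m B <= m A].
Proof.
move=> mA A0; apply: contrapT => noB; apply: P_atomless; exists A; split => //.
  by rewrite mE// lte_fin.
move=> B mB BA; rewrite !mE//.
have DE := mDK mA mB BA.
have mD : measurable (A `\` B) by exact: measurableD.
have [BD|DB] := leP (m B) (m (A `\` B)).
  left; congr EFin; apply/eqP; rewrite eq_le m_ge0 andbT leNgt; apply/negP => B0.
  by apply: noB; exists B; split => //; rewrite DE; lra.
right; congr EFin; rewrite DE; apply/eqP; rewrite -subr_eq0 opprD addNKr oppr_eq0.
rewrite eq_le m_ge0 andbT leNgt; apply/negP => D0.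
by apply: noB; exists (A `\` B); split => //; rewrite DE; lra.
Qed.

(** A set that is not an atom splits into two parts of positive probability, and
    one of them has at most half of it; iterate. *)
Lemma atomless_small_subset A (e : R) : measurable A -> (0 < P A)%E -> 0 < e ->
  exists B, [/\ measurable B, B `<=` A, (0 < P B)%E & (P B < e%:E)%E].
Proof.
move=> mA; rewrite mE// lte_fin => A0 e0.
have H n : exists B, [/\ measurable B, B `<=` A, 0 < m B & 2 ^+ n * m B <= m A].
  elim: n => [|n [B [mB BA B0 IH]]].
    by exists A; split => //; rewrite expr0 mul1r.
  have [C [mC CB C0 CBle]] := half_subset mB B0.
  exists C; split => //; first exact: subset_trans BA.
  apply: le_trans IH; rewrite exprSr -mulrA.
  by apply: ler_wpM2l => //; apply: exprn_ge0.
pose n := (Num.truncn (m A / e)).+1.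
have nP : m A / e < n%:R.
  by have /truncn_itv/andP[] : 0 <= m A / e by rewrite divr_ge0// ltW.
have [B [mB BA B0 Bn]] := H n.
exists B; rewrite mE// !lte_fin; split => //.
have n2 : n%:R <= 2 ^+ n :> R by rewrite -natrX ler_nat ltnW// ltn_expl.
rewrite ltr_pdivrMr// in nP.
have e2 : n%:R * e <= 2 ^+ n * e by rewrite ler_pM2r.
have := le_lt_trans Bn (lt_le_trans nP e2).
by rewrite ltr_pM2l// exprn_gt0.
Qed.

(** Sierpinski's theorem. Build an increasing sequence of subsets of probability
    at most t, gaining at each step at least half of what can be gained. If the
    union stopped short of t, some set D of small positive probability could
    still be added at every step, so that each step would gain at least P(D)/2,
    which is impossible in a bounded sequence. *)
Lemma atomless_subset A (t : R) : measurable A -> 0 <= t -> (t%:E <= P A)%E ->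
  exists B, [/\ measurable B, B `<=` A & P B = t%:E].
Proof.
move=> mA t0; rewrite mE// lee_fin => tA.
pose good S := [/\ measurable S, S `<=` A & m S <= t].
pose step (S S' : {S | good S}) := sval S `<=` sval S' /\
  forall D, good D -> sval S `<=` D ->
    m D - m (sval S) <= 2 * (m (sval S') - m (sval S)).
have stepP S : {S' | step S S'}.
  apply/cid; case: S => S gS.
  pose E := [set m D | D in [set D | good D /\ S `<=` D]].
  have ES : E (m S) by exists S => //; split.
  have Eub : ubound E t by move=> _ [D [[_ _ Dt] _] <-].
  have supE : has_sup E by split; [exists (m S)|exists t].
  have ubE D : good D -> S `<=` D -> m D <= sup E.
    by move=> gD SD; apply: ub_le_sup; [exact: supE.2|exists D].
  have := ubE S gS (@subset_refl _ S); rewrite le_eqVlt => /orP[/eqP SE|SE].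
    exists (exist _ S gS); split => //= D gD SD.
    by have := ubE D gD SD; rewrite -SE; lra.
  have [_ [D [gD SD] <-]] := @sup_adherent _ E ((sup E - m S) / 2) ltac:(lra) supE.
  move=> Dlt; exists (exist _ D gD); split => //= D' gD' SD'.
  by have := ubE D' gD' SD'; lra.
have g0 : good set0 by split => //; rewrite /m measure0.
have [F [_ Fstep]] := dependent_choice stepP (exist _ set0 g0).
pose S n := sval (F n).
have gS n : good (S n) by exact: svalP (F n).
have Snd : nondecreasing_seq S.
  apply/nondecreasing_seqP => n; apply/subsetPset; exact: (Fstep n).1.
pose B := \bigcup_n S n.
have mB : measurable B by apply: bigcupT_measurable => n; have [] := gS n.
have BA : B `<=` A by apply: bigcup_sub => n _; have [] := gS n.
have SB n : S n `<=` B by exact: bigcup_sup.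
have Bt : m B <= t.
  rewrite -lee_fin -mE//.
  have cvgB := nondecreasing_cvg_mu (mu := P) (fun n => let: And3 h _ _ := gS n in h) mB Snd.
  rewrite -(cvg_lim _ cvgB)//; apply: lime_le; first by apply/cvg_ex; eexists; exact: cvgB.
  by apply: nearW => n /=; have [mS _ St] := gS n; rewrite mE// lee_fin.
exists B; split => //; rewrite mE//; congr EFin.
apply/eqP; move: Bt; rewrite le_eqVlt => /orP[//|Bt].
exfalso.
have mAB : measurable (A `\` B) by exact: measurableD.
have AB0 : (0 < P (A `\` B))%E.
  by rewrite mE// lte_fin; have := mDK mA mB BA; lra.
have [D [mD DAB]] := atomless_small_subset (e := t - m B) mAB AB0 ltac:(lra).
rewrite mE// !lte_fin => D0 De.
have incr n : m D <= 2 * (m (S n.+1) - m (S n)).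
  have [mS SA St] := gS n.
  have SD0 : S n `&` D = set0.
    by apply/seteqP; split => // x [/SB Bx /DAB[]].
  have gSD : good (S n `|` D).
    split; [exact: measurableU| |by rewrite mU//; have := le_m mS mB (SB n); lra].
    by rewrite subUset; split => // x /DAB[].
  by have := (Fstep n).2 _ gSD (@subsetUl _ _ _); rewrite mU// addrAC subrr add0r.
have grow n : n%:R * m D <= 2 * m (S n).
  elim: n => [|n IH]; first by rewrite mul0r mulr_ge0.
  by rewrite -natr1 mulrDl mul1r; have := incr n; lra.
pose n := (Num.truncn (2 * t / m D)).+1.
have nP : 2 * t / m D < n%:R.
  by have /truncn_itv/andP[] : 0 <= 2 * t / m D by rewrite divr_ge0// mulr_ge0.
rewrite ltr_pdivrMr// in nP.
by have := grow n; have [_ _] := gS n; lra.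
Qed.

End atomless.

(** * Exchanging the values of a variable between two sets *)

Lemma pos_measure_ae d (T : measurableType d) (R : realType)
    (P : probability T R) (A : set T) (Q : T -> Prop) :
  measurable A -> (0 < P A)%E -> (\forall w \ae P, Q w) -> exists w, A w /\ Q w.
Proof.
move=> mA A0 aeQ; apply: contrapT => noW.
have : P.-negligible A.
  by apply: negligibleS aeQ => w Aw Qw; apply: noW; exists w.
by move/measure_negligible => /(_ mA) A00; rewrite A00 ltxx in A0.
Qed.

Lemma Linfty_bounded d (T : measurableType d) (R : realType)
    (P : probability T R) (f : T -> R) (M : R) : measurable_fun setT f ->
  (\forall w \ae P, `|f w| <= M) -> f \in Lfun P +oo%E.
Proof.
move=> mf fM; rewrite inE/=; apply/andP; split; rewrite inE//=.
rewrite /finite_norm unlock /Lnorm; case: ifPn => // P0.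
apply: (@le_lt_trans _ _ M%:E); last exact: ltry.
by apply/ess_supP; apply: filterS fM => w; rewrite /= lee_fin.
Qed.

Section overwrite.
Context d (T : measurableType d) (R : realType) (P : probability T R).
Implicit Types (X : T -> R) (A B : set T) (a b : R).

Definition overwrite X A B a b : T -> R :=
  fun w => if w \in A then a else if w \in B then b else X w.

Lemma overwrite_in1 X A B a b w : A w -> overwrite X A B a b w = a.
Proof. by move=> Aw; rewrite /overwrite mem_set. Qed.

Lemma overwrite_in2 X A B a b w : A `&` B = set0 -> B w ->
  overwrite X A B a b w = b.
Proof.
move=> AB0 Bw; rewrite /overwrite (mem_set Bw) memNset// => Aw.
by have : (A `&` B) w by []; rewrite AB0.
Qed.

Lemma overwrite_out X A B a b w : ~ A w -> ~ B w -> overwrite X A B a b w = X w.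
Proof. by move=> Aw Bw; rewrite /overwrite !memNset. Qed.

Lemma measurable_overwrite X A B a b : measurable A -> measurable B ->
  measurable_fun setT X -> measurable_fun setT (overwrite X A B a b).
Proof.
have mem_mfun D : measurable D -> measurable_fun setT (fun w : T => w \in D).
  move=> mD; apply: (measurable_fun_bool true); rewrite setTI.
  by rewrite (_ : _ @^-1` _ = D)//; apply/seteqP; split => w => [/set_mem|/mem_set].
move=> mA mB mX; apply: measurable_fun_ifT => //; first exact: mem_mfun.
by apply: measurable_fun_ifT => //; exact: mem_mfun.
Qed.

(** The law records only how much probability receives a and how much receives b,
    and these amounts are equal. *)
Lemma overwrite_sym_law X A B a b (C : set R) :
  measurable A -> measurable B -> A `&` B = set0 -> P A = P B ->
  measurable_fun setT X -> measurable C ->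
  P (overwrite X A B a b @^-1` C) = P (overwrite X A B b a @^-1` C).
Proof.
move=> mA mB AB0 PAB mX mC.
pose hit c (D : set T) := if c \in C then D else set0.
have hitP c D w : hit c D w <-> D w /\ C c.
  rewrite /hit; case: ifPn => [/set_mem|/negP] Cc; first by split=> [|[]].
  by split=> // -[_ /mem_set].
have mhit c D : measurable D -> measurable (hit c D) by rewrite /hit; case: ifP.
have Phit c : P (hit c A) = P (hit c B) by rewrite /hit; case: ifP.
have mXC : measurable (X @^-1` C `\` (A `|` B)).
  apply: measurableD; last exact: measurableU.
  by rewrite -[X in measurable X]setTI; exact: mX.
have decomp a' b' : P (overwrite X A B a' b' @^-1` C) =
    (P (hit a' A) + (P (hit b' B) + P (X @^-1` C `\` (A `|` B))))%E.
  have hAB w : A w -> B w -> False.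
    by move=> Aw Bw; have : (A `&` B) w by []; rewrite AB0.
  rewrite -measureU//; [|exact: mhit|]; last first.
    by apply/seteqP; split => // w [/hitP[? _] [_]]; apply; right.
  rewrite -measureU//; [|exact: mhit|apply: measurableU => //; exact: mhit|]; last first.
    by apply/seteqP; split => // w [/hitP[Aw _] [/hitP[/hAB]|[_]]]; [exact|apply; left].
  congr (P _); apply/seteqP; split => w; rewrite /preimage/=.
    have [Aw|nAw] := pselect (A w).
      by rewrite overwrite_in1// => Ca; left; apply/hitP.
    have [Bw|nBw] := pselect (B w).
      by rewrite overwrite_in2// => Cb; right; left; apply/hitP.
    by rewrite overwrite_out// => CX; right; right; split => // -[].
  move=> [/hitP[Aw Ca]|[/hitP[Bw Cb]|[CX nABw]]].
  - by rewrite overwrite_in1.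
  - by rewrite overwrite_in2.
  - by rewrite overwrite_out// => ?; apply: nABw; [left|right].
by rewrite !decomp !addeA Phit (Phit b) (addeC (P (hit a B))).
Qed.

End overwrite.

(** * The risk of exchanged and of nonzero nonnegative variables *)

Section risk.
Context d (T : measurableType d) (R : realType) (P : probability T R).

Lemma Linfty_ae_bounded (X : Linfty P) : exists M, \forall w \ae P, `|X w| <= M.
Proof.
have := Lfunction_finite _ X; rewrite /finite_norm unlock.
case: ifPn => [_|]; last by rewrite [X in (_ < X)%E](probability_setT P) lte01.
by move=> /ess_supr_bounded.
Qed.

Lemma overwrite_Linfty (X : Linfty P) A B a b : measurable A -> measurable B ->
  overwrite X A B a b \in Lfun P +oo%E.
Proof.
move=> mA mB; have [M XM] := Linfty_ae_bounded X.
apply: (@Linfty_bounded _ _ _ _ _ (Num.max M (Num.max `|a| `|b|))).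
  by apply: measurable_overwrite.
apply: filterS XM => w XM; rewrite /overwrite !le_max.
by case: ifP => _; [|case: ifP => _]; rewrite ?lexx ?XM ?orbT.
Qed.

Definition Linfty_overwrite (X : Linfty P) A B (mA : measurable A)
    (mB : measurable B) a b : Linfty P :=
  Lfun_Sub (leey (1 : \bar R)%E) (overwrite_Linfty X a b mA mB).

Context (rho : Linfty P -> R).
Context (rho_monotone : monotone_functional rho).
Context (rho_convex : convex_functional rho).
Context (rho_law_invariant : law_invariant rho).

Lemma rho_overwrite_sym (X : Linfty P) A B (mA : measurable A)
    (mB : measurable B) a b : A `&` B = set0 -> P A = P B ->
  rho (- Linfty_overwrite X mA mB a b) = rho (- Linfty_overwrite X mA mB b a).
Proof.
move=> AB0 PAB; apply: rho_law_invariant => C mC.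
have mNC : measurable (-%R @^-1` C).
  by rewrite -[X in measurable X]setTI; exact: oppr_measurable.
exact: (overwrite_sym_law a b mA mB AB0 PAB _ mNC).
Qed.

Context (P_atomless : atomless P).
Context (K : R).
Context (rho_cst_increasing :
    {in `[0, K] &, {homo (fun m : R => rho (- Linfty_cst P m)) : m n / m < n}}).

Lemma rho_opp_cst0 : rho (- Linfty_cst P 0) = rho 0.
Proof.
by congr rho; apply/LfuneqP => w /=; rewrite oppr0.
Qed.

(** Induction on n with P(A) >= 2^-n. Inside A and inside the complement take sets
    A' and B' of probability 2^-(n+1). The variables e 1_A' and e 1_B' have the
    same law, so by convexity their mean (e/2) 1_(A' U B') is no riskier than
    e 1_A', and it lives on a set of probability 2^-n. *)
Lemma rho0_lt_opp (Y : Linfty P) A (e : R) : measurable A -> (0 < P A)%E ->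
  0 < e <= K -> (\forall w \ae P, 0 <= Y w) -> (\forall w \ae P, A w -> e <= Y w) ->
  rho 0 < rho (- Y).
Proof.
move=> mA PA0.
have Afin : P A \is a fin_num by exact: fin_num_measure.
pose p := fine (P A).
have p0 : 0 < p by rewrite fine_gt0// PA0 ltey_eq Afin.
have [n] : exists n, 2 ^- n <= p.
  pose n := (Num.truncn p^-1).+1; exists n.
  rewrite -[p]invrK lef_pV2 ?posrE ?invr_gt0 ?exprn_gt0//.
  have /truncn_itv/andP[_ /ltW] : 0 <= p^-1 by rewrite invr_ge0 ltW.
  by move=> /le_trans; apply; rewrite -natrX ler_nat ltnW// ltn_expl.
rewrite -lee_fin fineK// => {p p0}; clear PA0 Afin.
elim: n A mA Y e => [|n IH] A mA Y e nA /andP[e0 eK] Y0 YA.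
  have PA1 : P A = 1%E.
    by apply/le_anti; rewrite probability_le1//=; move: nA; rewrite expr0 invr1.
  rewrite -rho_opp_cst0.
  apply: (@lt_le_trans _ _ (rho (- Linfty_cst P e))).
    apply: rho_cst_increasing => //; rewrite in_itv/= ?lexx ?(ltW e0)//=.
    by rewrite (le_trans (ltW e0)).
  apply: rho_monotone.
  have PAC : P (~` A) = 0%E by rewrite probability_setC// PA1 subee.
  have aeA : \forall w \ae P, A w.
    by apply/negligibleP => //; exact: measurableC.
  by apply: filterS2 aeA YA => w Aw; exact.
have q0 : 0 <= 2 ^- n.+1 :> R by rewrite invr_ge0 exprn_ge0.
have qE : 2 ^- n = 2 ^- n.+1 + 2 ^- n.+1 :> R.
  by rewrite exprS invfM; field.
have q2 : 2 ^- n.+1 + 2 ^- n.+1 <= 1 :> R.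
  by rewrite -qE invf_le1 ?exprn_gt0// exprn_ege1// ler1n.
have [A' [mA' A'A PA']] := atomless_subset P_atomless mA q0 nA.
have [|B' [mB' B'A' PB']] := atomless_subset P_atomless (measurableC mA') q0.
  by rewrite probability_setC// PA' -EFinB lee_fin lerBrDr.
have AB0 : A' `&` B' = set0 by apply/seteqP; split => // w [Aw /B'A'].
have PAB : P (A' `|` B') = (2 ^- n)%:E.
  rewrite qE EFinD -{1}PA' -PB'.
  exact: measureU.
pose Z1 := Linfty_overwrite 0 mA' mB' e 0.
pose Z2 := Linfty_overwrite 0 mA' mB' 0 e.
have ZE w : (2^-1 *: Z1 + (1 - 2^-1) *: Z2) w =
  2^-1 * overwrite (cst 0) A' B' e 0 w + (1 - 2^-1) * overwrite (cst 0) A' B' 0 e w.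
  by [].
have rhoZ : rho (- Z1) = rho (- Z2).
  by apply: rho_overwrite_sym => //; rewrite PA' PB'.
have Z1Y : rho (- Z1) <= rho (- Y).
  apply: rho_monotone; apply: filterS2 Y0 YA => w Yw0 YAw.
  rewrite /= /overwrite; case: ifPn => [/set_mem/A'A/YAw//|_].
  by case: ifPn.
have h2 : 0 <= (2^-1 : R) <= 1 by apply/andP; split; lra.
have := rho_convex (- Z1) (- Z2) h2.
rewrite -rhoZ -mulrDl subrKC mul1r => cvxZ.
apply: lt_le_trans (le_trans cvxZ Z1Y).
have -> : 2^-1 *: - Z1 + (1 - 2^-1) *: - Z2 = - (2^-1 *: Z1 + (1 - 2^-1) *: Z2).
  by rewrite !scalerN opprD.
apply: (IH (A' `|` B') _ _ (e / 2)).
- exact: measurableU.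
- by rewrite PAB lexx.
- lra.
- apply: aeW => w; rewrite ZE /overwrite.
  by case: ifP => _; [|case: ifP => _]; rewrite /cst; lra.
- apply: aeW => w ABw; rewrite ZE.
  move: ABw => [|] ABw; first by rewrite !(overwrite_in1 _ _ _ _ ABw); lra.
  by rewrite !(overwrite_in2 _ _ _ AB0 ABw); lra.
Qed.

End risk.

(** * The effect of an exchange on the expectation *)

Section expectation_overwrite.
Context d (T : measurableType d) (R : realType) (P : probability T R).

Lemma ae_pos_integrable (phi : {RV P >-> R}) (c : R) :
  (\forall w \ae P, 0 < phi w) -> ('E_P[phi] = c%:E)%E ->
  (phi : T -> R) \in Lfun P 1%E.
Proof.
move=> phi0; rewrite unlock => phic; apply/Lfun1_integrable/integrableP.
split; first exact/measurable_EFinP.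
rewrite (_ : integral _ _ _ = c%:E) ?ltry// -phic; apply: ae_eq_integral => //.
- by apply: measurableT_comp => //; exact/measurable_EFinP.
- exact/measurable_EFinP.
- by apply: filterS phi0 => w phiw _; rewrite /= gtr0_norm.
Qed.

Lemma Lfun1M_Linfty (phi : T -> R) (X : Linfty P) :
  phi \in Lfun P 1%E -> (phi \* X)%R \in Lfun P 1%E.
Proof.
move=> /Lfun1_integrable iphi; apply/Lfun1_integrable.
have mphi : measurable_fun setT phi by have /measurable_EFinP := measurable_int _ iphi.
have [M XM] := Linfty_ae_bounded X.
have mphiX : measurable_fun setT (phi \* X) by apply: measurable_funM.
have iM : P.-integrable setT (fun w => M%:E * (phi w)%:E)%E.
  exact: integrableZl.
apply/integrableP; split; first exact/measurable_EFinP.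
case/integrableP: iM => mM; apply: le_lt_trans.
apply: ae_ge0_le_integral => //.
- by apply: measurableT_comp => //; exact/measurable_EFinP.
- exact: measurableT_comp.
- apply: filterS XM => w XM _; rewrite -EFinM /= lee_fin !normrM mulrC.
  by apply: ler_wpM2r => //; apply: le_trans XM (ler_norm _).
Qed.

Lemma expectation_overwrite (phi : T -> R) (X : Linfty P) A B
    (mA : measurable A) (mB : measurable B) (a b l g p : R) :
  phi \in Lfun P 1%E -> A `&` B = set0 -> P A = p%:E -> P B = p%:E ->
  (forall w, A w -> - l <= phi w * (a - X w)) ->
  (forall w, B w -> g <= phi w * (b - X w)) ->
  ('E_P[(phi \* X)%R] + ((g - l) * p)%:E
    <= 'E_P[(phi \* Linfty_overwrite X mA mB a b)%R])%E.
Proof.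
move=> iphi AB0 PA PB lA gB.
have iphiX := Lfun1M_Linfty X iphi.
have iind (D : set T) k : measurable D -> (k \o* \1_D : T -> R) \in Lfun P 1%E.
  move=> mD; apply/Lfun1_integrable.
  rewrite (_ : _ \o _ = fun w => (k%:E * (\1_D w)%:E)%E); last first.
    by apply/funext => w; rewrite /= mulrC.
  by apply: integrableZl => //; exact: integrable_indic.
have iind1 (D : set T) : measurable D -> (\1_D : T -> R) \in Lfun P 1%E.
  by move=> mD; apply/Lfun1_integrable; exact: integrable_indic.
have -> : ('E_P[(phi \* X)%R] + ((g - l) * p)%:E =
    'E_P[((phi \* X) \+ ((- l) \o* \1_A \+ g \o* \1_B))%R])%E.
  rewrite !expectationD//; [|exact: iind..|by apply: rpredD; exact: iind].
  rewrite !expectationZl//; [|exact: iind1..].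
  rewrite !expectation_indic// PA PB -!EFinM -EFinD.
  by congr (_ + _%:E)%E; ring.
(* Off A and B the two integrands agree. *)
rewrite unlock; apply: le_integral => //.
- by apply/Lfun1_integrable; apply: rpredD => //; apply: rpredD; exact: iind.
- exact/Lfun1_integrable/Lfun1M_Linfty.
move=> w _; rewrite /= lee_fin !indicE.
have [Aw|nAw] := pselect (A w).
  have nBw : ~ B w by move=> Bw; have : (A `&` B) w by []; rewrite AB0.
  rewrite (mem_set Aw) (memNset nBw) overwrite_in1//.
  by have := lA w Aw; rewrite mulrBr /=; lra.
have [Bw|nBw] := pselect (B w).
  rewrite (mem_set Bw) (memNset nAw) overwrite_in2//.
  by have := gB w Bw; rewrite mulrBr /=; lra.
by rewrite !memNset// overwrite_out//=; lra.
Qed.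

(** The exchange loses at most (a - b + eta) s per unit of probability on A and
    gains at least (a - b - eta) t on B, where eta bounds the error made in
    replacing X by its lower value on each set. *)
Lemma expectation_overwrite_swap (phi : T -> R) (X : Linfty P) A B
    (mA : measurable A) (mB : measurable B) (a b s t eta p : R) :
  phi \in Lfun P 1%E -> A `&` B = set0 -> P A = p%:E -> P B = p%:E -> 0 < p ->
  0 <= s -> 0 <= t -> eta <= a - b -> (a - b + eta) * s < (a - b - eta) * t ->
  (forall w, A w -> phi w <= s /\ a <= X w < a + eta) ->
  (forall w, B w -> t <= phi w /\ b <= X w < b + eta) ->
  ('E_P[(phi \* X)%R] < 'E_P[(phi \* Linfty_overwrite X mA mB b a)%R])%E.
Proof.
move=> iphi AB0 PA PB p0 s0 t0 eta_ab gain sliceA sliceB.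
have lossA w : A w -> - ((a - b + eta) * s) <= phi w * (b - X w).
  move=> /sliceA[ws /andP[aw wa]].
  have : phi w * (X w - b) <= s * (X w - b) by apply: ler_wpM2r => //; lra.
  have : s * (X w - b) <= s * (a - b + eta) by apply: ler_wpM2l => //; lra.
  lra.
have gainB w : B w -> (a - b - eta) * t <= phi w * (a - X w).
  move=> /sliceB[wt /andP[bw wb]].
  have : t * (a - X w) <= phi w * (a - X w) by apply: ler_wpM2r => //; lra.
  have : t * (a - b - eta) <= t * (a - X w) by apply: ler_wpM2l => //; lra.
  lra.
apply: lt_le_trans (expectation_overwrite mA mB iphi AB0 PA PB lossA gainB).
rewrite lteDl ?expectation_fin_num ?Lfun1M_Linfty// lte_fin mulr_gt0//.
by rewrite subr_gt0.
Qed.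

Lemma measurable_slice (X : {mfun T >-> R}) (x y : R) :
  measurable [set w | x <= X w < y].
Proof.
rewrite (_ : [set _ | _] = X @^-1` `[x, y[).
  by rewrite -[X in measurable X]setTI; exact: measurable_funP.
by apply/seteqP; split => w; rewrite /preimage/= in_itv.
Qed.

(** Countably many slices of width eta cover almost all of A. *)
Lemma slice_pos (X : {RV P >-> R}) (A : set T) (eta : R) :
  measurable A -> (0 < P A)%E -> (\forall w \ae P, 0 <= X w) -> 0 < eta ->
  exists k : nat, (0 < P (A `&` [set w | (k%:R * eta <= X w < k.+1%:R * eta)%R]))%E.
Proof.
move=> mA A0 X0 eta0.
pose S k := A `&` [set w | k%:R * eta <= X w < k.+1%:R * eta].
have mS k : measurable (S k).
  by apply: measurableI => //; exact: measurable_slice.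
apply: contrapT => noS.
have S0 k : P.-negligible (S k).
  apply/negligibleP => //; apply/eqP; rewrite eq_le measure_ge0 andbT leNgt.
  by apply/negP => Sk; apply: noS; exists k.
have aeS : \forall w \ae P, ~ (\bigcup_k S k) w.
  by apply: negligibleS (negligible_bigcup S0) => w /contrapT.
have [w [Aw [Xw0]]] := pos_measure_ae mA A0 (filterI X0 aeS).
apply; exists (Num.truncn (X w / eta)) => //; split => //=.
rewrite -ler_pdivlMr// -ltr_pdivrMr//.
by apply: truncn_itv; rewrite divr_ge0// ltW.
Qed.

End expectation_overwrite.

(** * Solutions of the Neyman-Pearson problem *)

Section solution.
Context d (T : measurableType d) (R : realType) (P : probability T R).
Context (P_atomless : atomless P) (K : R) (phi : {RV P >-> R}).
Context (iphi : (phi : T -> R) \in Lfun P 1%E).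
Context (phi_gt0 : \forall w \ae P, 0 < phi w).
Context (rho : Linfty P -> R).
Context (rho_monotone : monotone_functional rho).
Context (rho_convex : convex_functional rho).
Context (rho_law_invariant : law_invariant rho).
Context (rho_cst_increasing :
    {in `[0, K] &, {homo (fun m : R => rho (- Linfty_cst P m)) : m n / m < n}}).
Context (v : R) (v_ge0 : 0 <= v) (X : Linfty P).
Context (X_solution : NP_solution rho phi K v X).

(** Scaling Y down to meet the constraint exactly moves it towards 0, whose risk is
    strictly smaller. *)
Lemma slack_suboptimal (Y : Linfty P) : rho 0 < rho (- X) ->
  rho (- Y) <= rho (- X) -> (\forall w \ae P, 0 <= Y w <= K) ->
  ~ (v%:E < 'E_P[(phi \* Y)%R])%E.
Proof.
move=> X0 YX YK; have iphiY := Lfun1M_Linfty Y iphi.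
rewrite -(fineK (expectation_fin_num iphiY)) lte_fin; set e := fine _ => ve.
have e0 : 0 < e by exact: le_lt_trans ve.
pose lam := v / e.
have lam01 : 0 <= lam < 1.
  by rewrite /lam divr_ge0 ?(ltW e0)//= ltr_pdivrMr// mul1r.
have /andP[lam0 lam1] := lam01.
have : rho (- X) <= rho (- (lam *: Y)).
  apply: X_solution.2; split.
    apply: filterS YK => w /andP[Yw0 YwK].
    change (0 <= lam * Y w <= K); rewrite mulr_ge0//=.
    by apply: le_trans YwK; rewrite ler_piMl// ltW.
  rewrite (_ : (fun w => _) = (lam \o* (phi \* Y))%R); last first.
    by apply/funext => w; rewrite /= -mulrA [X in _ * X]mulrC.
  rewrite expectationZl// -(fineK (expectation_fin_num iphiY)) -/e -EFinM.
  by rewrite lee_fin /lam divfK// gt_eqF.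
have lamle : 0 <= lam <= 1 by rewrite lam0 ltW.
have := rho_convex (- Y) 0 lamle.
rewrite scaler0 addr0 scalerN => h1 h2.
have : lam * rho (- Y) <= lam * rho (- X) by apply: ler_wpM2l.
have : (1 - lam) * rho 0 < (1 - lam) * rho (- X) by rewrite ltr_pM2l//; lra.
lra.
Qed.

(** The core of the proof: two such events of positive probability would yield, by
    an exchange of values, a variable that contradicts [slack_suboptimal]. *)
Lemma no_inversion (s t c c' : R) : s < t -> c < c' ->
  P.-negligible [set w | phi w <= s /\ c' <= X w] \/
  P.-negligible [set w | t <= phi w /\ X w <= c].
Proof.
move=> st cc'.
set A0 := [set w | _ /\ _]; set B0 := [set w | _ /\ _].
have msub (Z : T -> R) (C : set R) :
    measurable_fun setT Z -> measurable C -> measurable (Z @^-1` C).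
  by move=> mZ mC; rewrite -[X in measurable X]setTI; exact: mZ.
have mA0 : measurable A0.
  rewrite (_ : A0 = phi @^-1` `]-oo, s] `&` X @^-1` `[c', +oo[).
    by apply: measurableI; apply: msub.
  by apply/seteqP; split => w; rewrite /preimage/= !in_itv/= andbT.
have mB0 : measurable B0.
  rewrite (_ : B0 = phi @^-1` `[t, +oo[ `&` X @^-1` `]-oo, c]).
    by apply: measurableI; apply: msub.
  by apply/seteqP; split => w; rewrite /preimage/= !in_itv/= andbT.
have [PA0|PA0] := eqVneq (P A0) 0%E; first by left; exact/negligibleP.
have [PB0|PB0] := eqVneq (P B0) 0%E; first by right; exact/negligibleP.
exfalso.
have {}PA0 : (0 < P A0)%E by rewrite lt0e PA0 measure_ge0.
have {}PB0 : (0 < P B0)%E by rewrite lt0e PB0 measure_ge0.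
have XK : \forall w \ae P, 0 <= X w <= K by have [[]] := X_solution.
have X0 : \forall w \ae P, 0 <= X w by apply: filterS XK => w /andP[].
have [w0 [[w0s w0c] [w0phi /andP[w00 w0K]]]] :=
  pos_measure_ae mA0 PA0 (filterI phi_gt0 XK).
have [w1 [[w1t w1c] w10]] := pos_measure_ae mB0 PB0 X0.
have s0 : 0 < s by lra.
have c0 : 0 <= c by lra.
have rhoX : rho 0 < rho (- X).
  apply: (rho0_lt_opp rho_monotone rho_convex rho_law_invariant P_atomless
    rho_cst_increasing (A := A0) (e := c')) => //.
    by apply/andP; split; lra.
  by apply: aeW => w [].
(* The a and b found below satisfy a - b > c' - c - eta, and this eta makes
   (c' - c - eta) (t - s) - eta (t + s) = 2 eta t > 0. *)
pose eta := (c' - c) * (t - s) / (4 * t).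
have etaE : eta * (4 * t) = (c' - c) * (t - s) by rewrite divfK// gt_eqF//; lra.
have eta0 : 0 < eta by rewrite divr_gt0// ?mulr_gt0//; lra.
have t0 : 0 < t by lra.
have eta4 : 4 * eta < c' - c.
  have cs0 : 0 < (c' - c) * s by rewrite mulr_gt0//; lra.
  by rewrite -(ltr_pM2r t0); lra.
have [i] := slice_pos mA0 PA0 X0 eta0; set A1 := (_ `&` _) => PA1.
have [j] := slice_pos mB0 PB0 X0 eta0; set B1 := (_ `&` _) => PB1.
have mslice k := measurable_slice X (k%:R * eta) (k.+1%:R * eta).
have mA1 : measurable A1 by exact: (measurableI _ _ mA0 (mslice i)).
have mB1 : measurable B1 by exact: (measurableI _ _ mB0 (mslice j)).
pose a := i%:R * eta; pose b := j%:R * eta.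
have sliceA w : A1 w -> [/\ phi w <= s, c' <= X w & a <= X w < a + eta].
  by move=> [[? ?]] /=; rewrite -natr1 mulrDl mul1r.
have sliceB w : B1 w -> [/\ t <= phi w, X w <= c & b <= X w < b + eta].
  by move=> [[? ?]] /=; rewrite -natr1 mulrDl mul1r.
have [u [/sliceA[_ uc /andP[au ua]] /andP[u0 uK]]] := pos_measure_ae mA1 PA1 XK.
have [u' [/sliceB[_ u'c /andP[bu' u'b]] _]] := pos_measure_ae mB1 PB1 XK.
have b0 : 0 <= b by rewrite mulr_ge0// ltW.
have a0 : 0 <= a by rewrite mulr_ge0// ltW.
have aK : a <= K by exact: le_trans uK.
have bK : b <= K by lra.
have fin D : measurable D -> P D = (fine (P D))%:E.
  by move=> mD; rewrite fineK// fin_num_measure.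
pose p := Num.min (fine (P A1)) (fine (P B1)).
have p0 : 0 < p.
  by rewrite lt_min -!lte_fin -!fin// PA1 PB1.
have [|A [mA AA1 PA]] := atomless_subset P_atomless mA1 (ltW p0).
  by rewrite fin// lee_fin ge_min lexx.
have [|B [mB BB1 PB]] := atomless_subset P_atomless mB1 (ltW p0).
  by rewrite fin// lee_fin ge_min lexx orbT.
have AB0 : A `&` B = set0.
  apply/seteqP; split => // w [/AA1/sliceA[ws _ _] /BB1/sliceB[wt _ _]].
  by move: ws wt; rewrite /=; lra.
(* Y takes b on A and a on B, that is, the two lower values exchanged. *)
pose Y := Linfty_overwrite X mA mB b a.
apply: (@slack_suboptimal Y) => //.
- rewrite (rho_overwrite_sym rho_law_invariant)//; last by rewrite PA PB.
  apply: rho_monotone; apply: aeW => w /=.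
  have [/[dup] Aw /AA1/sliceA[_ _ /andP[aw _]]|nAw] := pselect (A w).
    by rewrite overwrite_in1.
  have [/[dup] Bw /BB1/sliceB[_ _ /andP[bw _]]|nBw] := pselect (B w).
    by rewrite overwrite_in2.
  by rewrite overwrite_out.
- apply: filterS XK => w; rewrite /= /overwrite => /andP[Xw0 XwK].
  by case: ifP => _; [|case: ifP => _]; rewrite ?Xw0 ?XwK ?a0 ?aK ?b0 ?bK.
apply: (@le_lt_trans _ _ ('E_P[(phi \* X)%R])%E); first by have [[]] := X_solution.
apply: (expectation_overwrite_swap (s := s) (t := t) (eta := eta) mA mB iphi
  AB0 PA PB p0).
- exact: ltW.
- exact: ltW.
- lra.
- have : (c' - c - eta) * (t - s) <= (a - b) * (t - s) by apply: ler_wpM2r; lra.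
  have : 0 < eta * t by rewrite mulr_gt0.
  lra.
- by move=> w /AA1/sliceA[].
- by move=> w /BB1/sliceB[].
Qed.

End solution.

(** * From the absence of inversions to an increasing function *)

Lemma ae_notin_negligible d (T : measurableType d) (R : realType)
    (mu : {measure set T -> \bar R}) (I : countType) (F : I -> set T) :
  \forall w \ae mu, forall i, mu.-negligible (F i) -> ~ F i w.
Proof.
pose G n : set T :=
  if unpickle n is Some i then [set w | mu.-negligible (F i) /\ F i w] else set0.
have G0 n : mu.-negligible (G n).
  rewrite /G; case: unpickle => [i|]; last exact: negligible_set0.
  have [Fi|Fi] := pselect (mu.-negligible (F i)).
    by apply: negligibleS Fi => w [].
  by apply: negligibleS (negligible_set0 mu) => w [].
apply: negligibleS (negligible_bigcup G0) => w nF; apply: contrapT => nG.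
apply: nF => i Fi Fiw; apply: nG; exists (pickle i) => //.
by rewrite /G pickleK.
Qed.

(** If phi w < phi w' and X w > X w', rational thresholds separate both pairs of
    values; of the two events that they define, which contain w and w', one is
    null. It is enough to discard countably many null events. *)
Lemma no_inversion_comonotone d (T : measurableType d) (R : realType)
    (mu : {measure set T -> \bar R}) (phi X : T -> R) :
  (forall s t c c' : R, s < t -> c < c' ->
    mu.-negligible [set w | phi w <= s /\ c' <= X w] \/
    mu.-negligible [set w | t <= phi w /\ X w <= c]) ->
  exists G : set T, (\forall w \ae mu, G w) /\
    forall w w', G w -> G w' -> phi w < phi w' -> X w <= X w'.
Proof.
move=> noinv.
pose low (i : rat * rat) : set T :=
  [set w | phi w <= ratr i.1 /\ ratr i.2 <= X w].
pose high (i : rat * rat) : set T :=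
  [set w | ratr i.1 <= phi w /\ X w <= ratr i.2].
exists [set w | (forall i, mu.-negligible (low i) -> ~ low i w) /\
                (forall i, mu.-negligible (high i) -> ~ high i w)].
split; first by apply: filterI; exact: ae_notin_negligible.
move=> w w' [lw _] [_ hw'] phiww'; rewrite leNgt; apply/negP => XwX.
have between (x y : R) : x < y ->
    exists r r' : rat, [/\ x <= ratr r, (ratr r : R) < ratr r' & ratr r' <= y].
  move=> xy; have [r /[!in_itv]/= /andP[xr ry]] := rat_in_itvoo xy.
  have [r' /[!in_itv]/= /andP[rr' ry']] := rat_in_itvoo ry.
  by exists r, r'; split => //; exact: ltW.
have [s [t [ws st tw]]] := between _ _ phiww'.
have [c [c' [wc cc' cw]]] := between _ _ XwX.
have [null|null] := noinv _ _ _ _ st cc'.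
  by apply: (lw (s, c') null).
by apply: (hw' (t, c) null).
Qed.

(** The level set of X through w is the preimage under phi of some set, so it
    contains the whole fibre of phi through w. *)
Lemma preimage_measurable_factor (T : pointedType) d' (T' : measurableType d')
    (R : realType) (phi : T -> T') (X : T -> R) :
  measurable_fun setT (X : g_sigma_algebra_preimageType phi -> R) ->
  forall w w', phi w = phi w' -> X w = X w'.
Proof.
move=> mX w w' ww'.
have [B mB BX] := mX measurableT [set X w] (measurable_set1 _).
have : (setT `&` X @^-1` [set X w]) w by [].
rewrite -BX => -[_ Bw].
have : ([set: T] `&` phi @^-1` B) w' by split => //=; rewrite /preimage/= -ww'.
by rewrite BX => -[_].
Qed.

Lemma increasing_factor (T : Type) (R : realType) (G : set T) (phi X : T -> R)
    (K : R) :
  (forall w, G w -> 0 <= X w <= K) ->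
  (forall w w', G w -> G w' -> phi w <= phi w' -> X w <= X w') ->
  exists f : R -> R, {homo f : x y / x <= y} /\ forall w, G w -> X w = f (phi w).
Proof.
move=> XK mono.
(* The point 0 keeps the supremum meaningful when no point of G has phi w <= x. *)
pose E x := [set 0] `|` [set X w | w in [set w | G w /\ phi w <= x]].
have ubE x : has_ubound (E x).
  exists (Num.max 0 K) => _ [->|[w [/XK/andP[_ XwK] _] <-]]; rewrite le_max ?lexx//.
  by rewrite XwK orbT.
exists (fun x => sup (E x)); split => [x y xy|w Gw].
  apply: sup_le_ub; first by exists 0; left.
  move=> r [->|[w [Gw wx] <-]]; apply: (ub_le_sup (ubE y)); first by left.
  by right; exists w => //; split => //; exact: le_trans xy.
apply/le_anti/andP; split.
  by apply: (ub_le_sup (ubE _)); right; exists w.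
apply: sup_le_ub; first by exists 0; left.
move=> r [->|[w' [Gw' w'w] <-]]; first by have /andP[] := XK _ Gw.
exact: mono.
Qed.

Theorem proposition2p5
  (R : realType) (d : measure_display) (T : measurableType d)
  (P : probability T R) (P_atomless : atomless P)
  (K : R) (K_gt0 : 0 < K)
  (phi : {RV P >-> R})
  (phi_gt0 : \forall w \ae P, 0 < phi w)
  (phi_mean : ('E_P[phi] = 1)%E)
  (rho : Linfty P -> R)
  (rho_monotone : monotone_functional rho)
  (rho_convex : convex_functional rho)
  (rho_law_invariant : law_invariant rho)
  (rho_cst_continuous :
    {within `[0, K], continuous (fun m : R => rho (- Linfty_cst P m))})
  (rho_cst_increasing :
    {in `[0, K] &, {homo (fun m : R => rho (- Linfty_cst P m)) : m n / m < n}})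
  (rho_continuous_from_above : continuous_from_above rho)
  (v : R) (v_ge0 : 0 <= v) (v_leK : v <= K)
  (X : Linfty P)
  (X_solution : NP_solution rho phi K v X)
  (X_sigma_phi_measurable :
    measurable_fun setT (X : g_sigma_algebra_preimageType phi -> R)) :
  exists f : R -> R, {homo f : x y / x <= y} /\
    \forall w \ae P, X w = f (phi w).
Proof.
have XK : \forall w \ae P, 0 <= X w <= K by have [[]] := X_solution.
have iphi := ae_pos_integrable phi_gt0 phi_mean.
have [G [aeG Gmono]] := no_inversion_comonotone (no_inversion P_atomless iphi
  phi_gt0 rho_monotone rho_convex rho_law_invariant rho_cst_increasing v_ge0
  X_solution).
have [w [_ //]||f [f_homo Xf]] :=
  @increasing_factor T R (G `&` [set w | 0 <= X w <= K]) phi X K.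
  move=> w w' [Gw _] [Gw' _]; rewrite le_eqVlt => /orP[/eqP ww'|]; last exact: Gmono.
  by rewrite (preimage_measurable_factor X_sigma_phi_measurable ww').
exists f; split => //; apply: filterS2 aeG XK => w Gw XwK; exact: Xf.
Qed.
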